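(* Let $\alpha,\beta,\gamma\in\widehat{\kappa^*}$ satisfy $(\alpha+\alpha\gamma,\beta)=(\gamma,\varepsilon)=0$, and let $f\colon\widehat{\kappa^*}\to\mathbb{C}$ be any map. For all $x,y\in\kappa$ with $x\neq0,1$, \[ \sum_{\nu,\mu\in\widehat{\kappa^*}} f(\mu)\frac{(\alpha)_{\nu\mu}(\gamma)_\nu(\beta\overline{\gamma})_\mu}{(\beta)^\circ_{\nu\mu}(\varepsilon)^\circ_\nu(\varepsilon)^\circ_\mu}\nu(x)\mu(y) =\overline{\alpha}\overline{\gamma}\beta(1-x)\sum_{\eta\in\widehat{\kappa^*}}\frac{(\beta\overline{\alpha}+\beta\overline{\gamma})_\eta}{(\beta+\varepsilon)^\circ_\eta}\eta(x)\sum_{\mu\in\widehat{\kappa^*}}f(\mu)\frac{(\alpha+\overline{\eta})_\mu}{(\alpha\overline{\beta\eta}+\varepsilon)^\circ_\mu}\mu\!\left(\frac{y}{x}\right) \] \[ -(1-q)^2f(\overline{\alpha})\,\alpha\overline{\beta}(-x)\,\overline{\alpha}(-y)\,\overline{\alpha}\overline{\gamma}\beta(1-x)\frac{(\varepsilon)^\circ_\beta}{(\overline{\gamma})_\beta}+(1-q)^2f(\gamma\overline{\beta})\,\overline{\gamma}(x)\,\gamma\overline{\beta}(y)\frac{(\varepsilon)^\circ_\beta}{(\overline{\alpha})^\circ_\beta}. \]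
   Context: $\kappa$ is a finite field with $q$ elements; $\widehat{\kappa^*}=\mathrm{Hom}(\kappa^*,\mathbb{C}^* )$, written multiplicatively, characters extended by $\varphi(0)=0$; $\varepsilon$ trivial, $\overline{\varphi}=\varphi^{-1}$ (e.g. $\overline{\beta\eta}=(\beta\eta)^{-1}$). $\delta(\varphi)=1$ if $\varphi=\varepsilon$, else $0$. Fix a nontrivial additive character $\psi$; $g(\varphi)=-\sum_{x\in\kappa}\varphi(x)\psi(x)$, $g^\circ(\varphi)=q^{\delta(\varphi)}g(\varphi)$, $(\varphi)_\nu=g(\varphi\nu)/g(\varphi)$, $(\varphi)^\circ_\nu=g^\circ(\varphi\nu)/g^\circ(\varphi)$. $P$ is the free abelian monoid on $\widehat{\kappa^*}$ written additively, with symmetric bilinear pairing determined by $(\alpha,\beta)=\delta(\alpha\overline\beta)$ (so $(\alpha+\alpha\gamma,\beta)=0$ means $\beta\neq\alpha,\alpha\gamma$). For $\mathbf a=\alpha_1+\dots+\alpha_r\in P$, $(\mathbf a)_\nu=\prod(\alpha_i)_\nu$, $(\mathbf a)^\circ_\nu=\prod(\alpha_i)^\circ_\nu$. *)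

(* Defs.v *)
From HB Require Import structures.
From mathcomp Require Import all_boot all_order all_algebra all_fingroup.
From mathcomp Require Import cyclic reals complex.

Set Implicit Arguments.
Unset Strict Implicit.
Unset Printing Implicit Defensive.

Import GRing.Theory Num.Theory.
Local Open Scope ring_scope.

Section Characters.
Variables (F : finFieldType) (C : numClosedFieldType).

(* A monoid morphism from a group to (C, * ) takes its values in C^*, so [mchar]
   is the group Hom(F^*, C^* ). *)
Definition mchar_axiom (phi : {ffun {unit F} -> C}) : bool :=
  (phi 1%g == 1) && [forall u, forall v, phi (u * v)%g == phi u * phi v].

Record mchar := MChar { mchar_val : {ffun {unit F} -> C};
                        mchar_valP : mchar_axiom mchar_val }.

HB.instance Definition _ := [isSub for mchar_val].
HB.instance Definition _ := [Choice of mchar by <:].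

Lemma mchar_val1 (phi : mchar) : mchar_val phi 1%g = 1.
Proof. by case/andP: (mchar_valP phi) => /eqP. Qed.

Lemma mchar_valM (phi : mchar) u v :
  mchar_val phi (u * v)%g = mchar_val phi u * mchar_val phi v.
Proof. by case/andP: (mchar_valP phi) => _ /'forall_'forall_eqP. Qed.

Lemma mchar_valX (phi : mchar) u n :
  mchar_val phi (u ^+ n)%g = mchar_val phi u ^+ n.
Proof.
by elim: n => [|n IHn]; rewrite ?mchar_val1 // expgS mchar_valM IHn exprS.
Qed.

Lemma mchar_val_neq0 (phi : mchar) u : mchar_val phi u != 0.
Proof.
apply: contraTneq (oner_neq0 C) => phi0.
by rewrite -(mchar_val1 phi) -(mulgV u) mchar_valM phi0 mul0r eqxx.
Qed.

Let N := #|[set: {unit F}]%G|.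

Definition unity_roots : seq C := sval (closed_field_poly_normal ('X^N - 1%:P : {poly C})).

Lemma mem_unity_roots (phi : mchar) u : mchar_val phi u \in unity_roots.
Proof.
have N_gt0 : (0 < N)%N by apply: cardG_gt0.
rewrite /unity_roots; case: closed_field_poly_normal => rs /= def_p.
have : root ('X^N - 1%:P) (mchar_val phi u).
  rewrite /root !hornerE -mchar_valX /N expg_cardG ?inE //.
  by rewrite mchar_val1 subrr.
by rewrite def_p lead_coefXnsubC // scale1r root_prod_XsubC.
Qed.

Definition mchar_code (phi : mchar) :
    {ffun {unit F} -> 'I_(size unity_roots)} :=
  [ffun u => Ordinal (etrans (index_mem _ _) (mem_unity_roots phi u))].

Definition mchar_decode (c : {ffun {unit F} -> 'I_(size unity_roots)}) :
    option mchar :=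
  insub [ffun u => nth 0 unity_roots (c u)].

Lemma mchar_codeK : pcancel mchar_code mchar_decode.
Proof.
move=> phi; rewrite /mchar_decode.
suff -> : [ffun u => nth 0 unity_roots (mchar_code phi u)] = mchar_val phi.
  by rewrite (valK phi).
by apply/ffunP => u; rewrite !ffunE nth_index ?mem_unity_roots.
Qed.

HB.instance Definition _ := PCanIsCountable mchar_codeK.
HB.instance Definition _ : isFinite mchar := PCanIsFinite mchar_codeK.

Lemma mchar_one_subproof : mchar_axiom [ffun=> 1].
Proof.
rewrite /mchar_axiom ffunE eqxx.
by apply/'forall_'forall_eqP => u v; rewrite !ffunE mulr1.
Qed.

Lemma mchar_mul_subproof (phi chi : mchar) :
  mchar_axiom [ffun u => mchar_val phi u * mchar_val chi u].
Proof.
rewrite /mchar_axiom ffunE !mchar_val1 mulr1 eqxx.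
by apply/'forall_'forall_eqP => u v; rewrite !ffunE !mchar_valM mulrACA.
Qed.

Lemma mchar_inv_subproof (phi : mchar) :
  mchar_axiom [ffun u => (mchar_val phi u)^-1].
Proof.
rewrite /mchar_axiom ffunE mchar_val1 invr1 eqxx.
by apply/'forall_'forall_eqP => u v; rewrite !ffunE mchar_valM invfM.
Qed.

Definition mchar_one := MChar mchar_one_subproof.
Definition mchar_mul (phi chi : mchar) := MChar (mchar_mul_subproof phi chi).
Definition mchar_inv (phi : mchar) := MChar (mchar_inv_subproof phi).

Lemma mchar_mulA : associative mchar_mul.
Proof.
by move=> a b c; apply/val_inj/ffunP => u; rewrite /= !ffunE /= ?ffunE mulrA.
Qed.

Lemma mchar_mul1 : left_id mchar_one mchar_mul.
Proof. by move=> a; apply/val_inj/ffunP => u; rewrite /= !ffunE /= mul1r. Qed.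

Lemma mchar_mulV : left_inverse mchar_one mchar_inv mchar_mul.
Proof.
move=> a; apply/val_inj/ffunP => u.
by rewrite /= !ffunE /= mulVf ?mchar_val_neq0.
Qed.

HB.instance Definition _ :=
  Finite_isGroup.Build mchar mchar_mulA mchar_mul1 mchar_mulV.

(* Extension by phi(0) = 0. *)
Definition mchar_ext (phi : mchar) (x : F) : C :=
  if insub x is Some u then mchar_val phi u else 0.

Definition mdelta (phi : mchar) : nat := (phi == 1%g).

Definition additive_character (psi : F -> C) : Prop :=
  psi 0 = 1 /\ {morph psi : x y / x + y >-> x * y}.

Definition nontrivial_character (psi : F -> C) : Prop := exists x, psi x <> 1.

(* The free abelian monoid on the finite set of characters: a formal sum is
   given by its multiplicities, and addition is pointwise. *)
Definition formal_sum := {ffun mchar -> nat}.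
HB.instance Definition _ := GRing.Nmodule.on formal_sum.

Definition gen (alpha : mchar) : formal_sum := [ffun chi => (chi == alpha) : nat].

Definition pairing (a b : formal_sum) : nat :=
  (\sum_alpha \sum_beta a alpha * b beta * mdelta (alpha * beta^-1)%g)%N.

Variable psi : F -> C.

Definition gauss (phi : mchar) : C := - \sum_(x : F) mchar_ext phi x * psi x.

Definition gausso (phi : mchar) : C := #|F|%:R ^+ mdelta phi * gauss phi.

Definition poch (phi nu : mchar) : C := gauss (phi * nu)%g / gauss phi.

Definition pocho (phi nu : mchar) : C := gausso (phi * nu)%g / gausso phi.

Definition mpoch (a : formal_sum) (nu : mchar) : C :=
  \prod_alpha poch alpha nu ^+ a alpha.

Definition mpocho (a : formal_sum) (nu : mchar) : C :=
  \prod_alpha pocho alpha nu ^+ a alpha.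

End Characters.

Coercion mchar_ext : mchar >-> Funclass.

Bind Scope group_scope with mchar.
Arguments mchar_ext {F C} phi%_g x%_R.
Arguments mdelta {F C} phi%_g.
Arguments gen {F C} alpha%_g.
Arguments pairing {F C} a%_R b%_R.
Arguments gauss {F C} psi phi%_g.
Arguments gausso {F C} psi phi%_g.
Arguments poch {F C} psi phi%_g nu%_g.
Arguments pocho {F C} psi phi%_g nu%_g.
Arguments mpoch {F C} psi a%_R nu%_g.
Arguments mpocho {F C} psi a%_R nu%_g.

(* Main.v *)
Require Import Defs.
From mathcomp Require Import all_boot all_order all_algebra all_fingroup.
From mathcomp Require Import reals complex.
From mathcomp Require Import separable cyclic cyclotomic ring.

Import GRing.Theory Num.Theory.
Local Open Scope ring_scope.

(* The coefficient of f(mu) on the left is, up to a constant, the finite-field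
   2F1 with parameters (alpha mu, gamma; beta mu) at x; on the right it is the
   one with parameters (beta/alpha, beta mu/gamma; beta mu), after replacing eta
   by nu mu. So the identity is Euler's transformation, mu by mu. Over a finite
   field that transformation comes from the substitution w -> (1-w)/(1-xw) in
   the sum of a(w) (c/a)(1-w) b^-1(1-xw), and it acquires an extra term exactly
   when a = 1 or b = c, that is when mu = alpha^-1 or mu = gamma/beta. *)

(** * Characters of the multiplicative group: orthogonality, Mellin inversion, Jacobi sums *)

Section CharacterSums.
Set Implicit Arguments.
Unset Strict Implicit.
Unset Printing Implicit Defensive.

Variables (F : finFieldType) (C : numClosedFieldType).
Implicit Types (phi chi nu : mchar F C) (x y z : F).

Local Notation q := (#|F|%:R : C).

(** In characteristic 0 the polynomial [X^n - 1] is separable, so it has [n] distinct roots, and [n]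
    distinct n-th roots of unity include a primitive one. *)
Lemma prim_root_closed (n : nat) : (0 < n)%N -> exists z : C, n.-primitive_root z.
Proof.
move=> n_gt0; have [rs Drs] := closed_field_poly_normal ('X^n - 1 : {poly C}).
rewrite lead_coefDl ?size_polyXn ?size_polyN ?size_poly1 // in Drs.
rewrite lead_coefXn scale1r in Drs.
have sz_rs : size rs = n.
  by apply/succn_inj; rewrite -(size_prod_XsubC rs id) -Drs size_XnsubC.
suff /hasP[z _ z_prim] : has n.-primitive_root rs by exists z.
apply: has_prim_root; rewrite ?sz_rs //.
  by apply/allP => z; rewrite -root_prod_XsubC -Drs.
by rewrite -separable_prod_XsubC -Drs separable_Xn_sub_1 // pnatr_eq0 -lt0n.
Qed.

Lemma mchar_extE phi (u : {unit F}) : phi (val u) = mchar_val phi u.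
Proof. by rewrite /mchar_ext valK. Qed.

Lemma mchar_ext0 phi : phi 0 = 0.
Proof. by rewrite /mchar_ext insubF ?unitr0. Qed.

Lemma nonzero_val x : x != 0 -> {u : {unit F} | x = val u}.
Proof. by rewrite -unitfE => Ux; exists (Sub x Ux). Qed.

Lemma mchar_neq0 phi x : x != 0 -> phi x != 0.
Proof. by case/nonzero_val=> u ->; rewrite mchar_extE mchar_val_neq0. Qed.

Lemma mchar_extM phi x y : phi (x * y) = phi x * phi y.
Proof.
have [->|/nonzero_val[u ->]] := eqVneq x 0; first by rewrite !(mul0r, mchar_ext0).
have [->|/nonzero_val[v ->]] := eqVneq y 0; first by rewrite !(mulr0, mchar_ext0).
by rewrite -[val u * val v]/(val (u * v)%g) !mchar_extE mchar_valM.
Qed.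

Lemma mchar_ext1 phi : phi 1 = 1.
Proof. by rewrite -[1]/(val (1%g : {unit F})) mchar_extE mchar_val1. Qed.

Lemma mchar_extV phi x : phi x^-1 = (phi x)^-1.
Proof.
have [->|x0] := eqVneq x 0; first by rewrite invr0 mchar_ext0 invr0.
by apply: (mulIf (mchar_neq0 phi x0)); rewrite -mchar_extM !mulVf ?mchar_ext1 ?mchar_neq0.
Qed.

Lemma mchar_mulE phi chi x : (phi * chi)%g x = phi x * chi x.
Proof.
have [->|/nonzero_val[u ->]] := eqVneq x 0; first by rewrite !mchar_ext0 mul0r.
by rewrite !mchar_extE /= ffunE.
Qed.

Lemma mchar_invE phi x : (phi^-1)%g x = (phi x)^-1.
Proof.
have [->|/nonzero_val[u ->]] := eqVneq x 0; first by rewrite !mchar_ext0 invr0.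
by rewrite !mchar_extE /= ffunE.
Qed.

Lemma mchar_oneE x : (1%g : mchar F C) x = (x != 0)%:R.
Proof.
have [->|/nonzero_val[u ->]] := eqVneq x 0; first by rewrite !mchar_ext0.
by rewrite !mchar_extE /= ffunE.
Qed.

Lemma mcharP phi chi : (forall x, x != 0 -> phi x = chi x) -> phi = chi.
Proof.
move=> eq_pc; apply/val_inj/ffunP => u; rewrite -!mchar_extE eq_pc //.
by rewrite -unitfE (valP u).
Qed.

Lemma mchar_mulC phi chi : (phi * chi = chi * phi)%g.
Proof. by apply: mcharP => x _; rewrite !mchar_mulE mulrC. Qed.

Lemma mchar_sqrN1 phi : phi (-1) * phi (-1) = 1.
Proof. by rewrite -mchar_extM mulrNN mulr1 mchar_ext1. Qed.

Lemma mchar_signP phi : phi (-1) = 1 \/ phi (-1) = -1.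
Proof.
by have /eqP := mchar_sqrN1 phi; rewrite -expr2 sqrf_eq1 => /orP[]/eqP; [left|right].
Qed.

Lemma mchar_invN1 phi : (phi (-1))^-1 = phi (-1).
Proof. by rewrite -mchar_extV invrN1. Qed.

Lemma mchar_extN phi x : phi (- x) = phi (-1) * phi x.
Proof. by rewrite -[- x]mulN1r mchar_extM. Qed.

Definition mchar_evalE := (mchar_extM, mchar_extV, mchar_mulE, mchar_invE, invfM).

(** The multiplicative group is cyclic; sending a generator to a primitive root of unity of the same
    order gives an injective character. *)
Lemma mchar_separates x : x != 0 -> x != 1 -> exists phi, phi x != 1.
Proof.
case/nonzero_val=> u -> u1.
have /cyclicP[g Dg] := field_unit_group_cyclic [set: {unit F}]%G.
have [z z_prim] := prim_root_closed (order_gt0 g).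
have exg (v : {unit F}) : {i | (i < #[g]%g)%N & v = (g ^+ i)%g}.
  by apply: cyclePmin; rewrite -Dg inE.
pose h (v : {unit F}) := z ^+ s2val (exg v).
(* [exg] returns an exponent reduced modulo the order of [g]; as [z] has the same order, [h] can be
   computed from any exponent. *)
have hX i : h (g ^+ i)%g = z ^+ i.
  rewrite /h; case: (exg _) => j /= _ /eqP; rewrite eq_sym eq_expg_mod_order => gij.
  by apply/eqP; rewrite (eq_prim_root_expr z_prim).
have h_char : mchar_axiom [ffun v => h v].
  rewrite /mchar_axiom ffunE -(expg0 g) hX expr0 eqxx.
  apply/'forall_'forall_eqP => v w; rewrite !ffunE.
  have [i _ ->] := exg v; have [j _ ->] := exg w.
  by rewrite -expgD !hX exprD.
exists (MChar h_char); rewrite mchar_extE /= ffunE.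
have [i _ Du] := exg u; rewrite Du in u1 *.
apply: contra u1; rewrite hX -(expr0 z) (eq_prim_root_expr z_prim).
by rewrite -eq_expg_mod_order expg0 => /eqP->.
Qed.

Lemma sum_mchar phi : \sum_x phi x = (phi == 1%g)%:R * (q - 1).
Proof.
have [->|phi_neq1] := eqVneq phi 1%g.
  rewrite mul1r (bigD1 0) //= mchar_ext0 add0r.
  under eq_bigr => x x0 do rewrite mchar_oneE x0.
  by rewrite sumr_const cardC1 -subn1 natrB //; apply/card_gt0P; exists 0.
have [/existsP[y /andP[y0 py]]|] := boolP [exists y, (y != 0) && (phi y != 1)].
  rewrite mul0r; apply/eqP; move: py; apply: contraNT => sum_neq0.
  apply/eqP/(mulIf sum_neq0); rewrite mul1r [RHS](reindex_inj (mulfI y0)) /=.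
  by rewrite mulr_sumr; apply: eq_bigr => x _; rewrite mchar_extM.
rewrite negb_exists => /forallP phi1; case/eqP: phi_neq1; apply: mcharP => x x0.
by have := phi1 x; rewrite x0 /= negbK mchar_oneE x0 => /eqP.
Qed.

Lemma sum_mchar_at x : \sum_(phi : mchar F C) phi x = (x == 1)%:R * (q - 1).
Proof.
have sum0 y : y != 1 -> \sum_(phi : mchar F C) phi y = 0.
  have [-> _|y0 y1] := eqVneq y 0.
    by rewrite big1 // => phi _; rewrite mchar_ext0.
  have [chi] := mchar_separates y0 y1; apply: contraNeq => sum_neq0.
  apply/eqP/(mulIf sum_neq0); rewrite mul1r [RHS](reindex_inj (mulgI chi)) /=.
  by rewrite mulr_sumr; apply: eq_bigr => phi _; rewrite mchar_mulE.
have [->|/sum0->] := eqVneq x 1; last by rewrite mul0r.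
(* The value at 1 is the number of characters. It comes from double counting: by rows only the
   trivial character contributes, by columns only [y = 1]. *)
have: \sum_(phi : mchar F C) \sum_y phi y = q - 1.
  under eq_bigr do rewrite sum_mchar.
  by rewrite (bigD1 1%g) //= eqxx mul1r big1 ?addr0 // => phi /negPf->; rewrite mul0r.
by rewrite exchange_big (bigD1 1) //= [X in _ + X]big1 ?addr0 ?mul1r.
Qed.

(** Mellin inversion: orthogonality over [nu] keeps only the [w] with [w * z = 1]. *)
Lemma mchar_inversion (G : F -> C) z : z != 0 ->
  \sum_(nu : mchar F C) \sum_w G w * nu (w * z) = (q - 1) * G z^-1.
Proof.
move=> z0; rewrite exchange_big (bigD1 z^-1) //= -mulr_sumr mulVf // sum_mchar_at.
rewrite eqxx mul1r [_ * G _]mulrC big1 ?addr0 // => w wz.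
rewrite -mulr_sumr sum_mchar_at -(mulVf z0) (inj_eq (mulIf z0)) (negPf wz).
by rewrite mul0r mulr0.
Qed.

Definition jacobi phi chi : C := \sum_x phi x * chi (1 - x).

(* The substitution x = w / (w - 1). *)
Lemma jacobi_alt phi chi :
  jacobi phi chi = phi (-1) * \sum_w phi w * (phi * chi)^-1%g (1 - w).
Proof.
pose h x : F := x / (x - 1).
have hB x : x - 1 != 0 -> h x - 1 = (x - 1)^-1 by move=> x1; rewrite /h; field.
have hK x : x - 1 != 0 -> h (h x) = x by move=> x1; rewrite {1}/h hB // invrK divfK.
have supp (f1 f2 : mchar F C) :
    \sum_x f1 x * f2 (1 - x) = \sum_(x | x - 1 != 0) f1 x * f2 (1 - x).
  rewrite (bigID (fun x => x - 1 != 0)) /= [X in _ + X]big1 ?addr0 // => x.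
  by rewrite negbK subr_eq0 => /eqP->; rewrite subrr mchar_ext0 mulr0.
rewrite /jacobi supp (reindex_onto h h) /= => [|x]; last exact: hK.
rewrite supp mulr_sumr; apply: eq_big => [x|x].
  (* At the pole [x = 1] the convention [1 / 0 = 0] gives [h (h 1) = 0], so the reindexing condition
     [h (h x) == x] discards this point. *)
  have [x1|x1] := eqVneq (x - 1) 0; last by rewrite hB // invr_eq0 x1 hK ?eqxx.
  rewrite /h x1 invr0 mulr0 mul0r andbC eq_sym -(inj_eq (addIr (-1))) x1.
  by rewrite sub0r eq_sym oppr_eq0 oner_eq0.
have [x1|x1 _] := eqVneq (x - 1) 0.
  rewrite /h x1 invr0 mulr0 mul0r andbC eq_sym -(inj_eq (addIr (-1))) x1.
  by rewrite sub0r eq_sym oppr_eq0 oner_eq0.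
have -> : 1 - h x = -1 * (x - 1)^-1 by rewrite -hB //; ring.
have -> : 1 - x = -1 * (x - 1) by ring.
rewrite /h !mchar_evalE !mchar_invN1; apply/eqP; rewrite -subr_eq0; apply/eqP.
transitivity (phi x / phi (x - 1) * chi (-1) / chi (x - 1) * (1 - phi (-1) * phi (-1))).
  by ring.
by rewrite mchar_sqrN1 subrr mulr0.
Qed.

End CharacterSums.

(** * Gauss sums: products, reflection formula, inverses of Pochhammer symbols *)

Section GaussSums.
Set Implicit Arguments.
Unset Strict Implicit.
Unset Printing Implicit Defensive.

Variables (F : finFieldType) (C : numClosedFieldType) (psi : F -> C).
Hypothesis (psiD : additive_character psi) (psiN : nontrivial_character psi).
Implicit Types (phi chi nu a b c : mchar F C) (x y z : F).

Local Notation q := (#|F|%:R : C).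
Local Notation g := (gauss psi).

Lemma sum_additive_character : \sum_x psi x = 0.
Proof.
have [_ psiM] := psiD; have [y psi_y] := psiN.
have [//|sum_neq0] := eqVneq (\sum_x psi x) 0.
case: psi_y; apply: (mulIf sum_neq0); rewrite mul1r mulr_sumr.
by rewrite [RHS](reindex_inj (addrI y)) /=; apply: eq_bigr => x _; rewrite psiM.
Qed.

Lemma card_field_neq0 : q != 0.
Proof. by rewrite pnatr_eq0 -lt0n; apply/card_gt0P; exists 0. Qed.

(** The values of [psi] sum to 0 and [psi 0 = 1], so those at nonzero points sum to -1; the sign in
    [gauss] turns this into 1. *)
Lemma gauss1 : g 1%g = 1.
Proof.
have [psi0 _] := psiD.
apply/eqP; rewrite /gauss -subr_eq0 -opprD oppr_eq0 addrC.
rewrite -[X in _ == X]sum_additive_character; apply/eqP.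
rewrite [RHS](bigD1 0) //= psi0 (bigD1 0) //= mchar_ext0 mul0r add0r; congr (_ + _).
by apply: eq_bigr => x x0; rewrite mchar_oneE x0 mul1r.
Qed.

(** The double sum is sliced by [u], the sum of the two variables. A slice with [u != 0] rescales to
    a Jacobi sum; the slice [u = 0] is a complete character sum, which survives only if [phi * chi]
    is trivial. *)
Lemma gauss_mul phi chi :
  g phi * g chi = (phi * chi == 1)%g%:R * ((q - 1) * chi (-1))
                  - g (phi * chi)%g * jacobi phi chi.
Proof.
have [psi0 psiM] := psiD.
have -> : g phi * g chi =
    \sum_u \sum_s phi s * chi (u - s) * psi u.
  rewrite /gauss mulrNN mulr_suml exchange_big; apply: eq_bigr => s _ /=.
  rewrite mulr_sumr (reindex_inj (addIr (- s))) /=; apply: eq_bigr => u _.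
  have -> : psi u = psi s * psi (u - s) by rewrite -psiM addrC subrK.
  by ring.
rewrite (bigD1 0) //= psi0; congr (_ + _).
  rewrite -(mulrC (chi (-1))) mulrCA -sum_mchar mulr_sumr.
  by apply: eq_bigr => s _; rewrite mulr1 sub0r mchar_extN mchar_mulE; ring.
rewrite /gauss mulNr opprK mulr_suml [RHS](bigD1 0) //= mchar_ext0 !mul0r add0r.
apply: eq_bigr => u u0; rewrite (reindex_inj (mulfI u0)) /= mulr_sumr.
apply: eq_bigr => s _; have -> : u - u * s = u * (1 - s) by ring.
by rewrite !mchar_evalE; ring.
Qed.

Lemma gauss_inv phi :
  g phi * g (phi^-1)%g = phi (-1) * (q - (phi == 1%g)%:R * (q - 1)).
Proof.
rewrite gauss_mul jacobi_alt mulgV invg1 eqxx gauss1 mchar_invE mchar_invN1.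
rewrite (bigD1 1) //= subrr mchar_ext0 mulr0 add0r.
rewrite -[in RHS]sum_mchar [in RHS](bigD1 1) //= mchar_ext1.
under eq_bigr => w w1 do rewrite mchar_oneE subr_eq0 eq_sym w1 mulr1.
by ring.
Qed.

Lemma gauss_inv_neq1 phi : phi != 1%g -> g phi * g (phi^-1)%g = phi (-1) * q.
Proof. by move=> /negPf phi1; rewrite gauss_inv phi1 mul0r subr0. Qed.

(** The factor [q ^ delta] in [gausso] repairs exactly the trivial character, so the reflection
    formula holds without exception. *)
Lemma gausso_inv phi : gausso psi phi * g (phi^-1)%g = phi (-1) * q.
Proof.
rewrite /gausso /mdelta -mulrA gauss_inv.
case: eqP => [->|_]; last by rewrite expr0 mulr0n; ring.
by rewrite mchar_oneE oppr_eq0 oner_neq0 expr1 mulr1n; ring.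
Qed.

Lemma gauss_neq0 phi : g phi != 0.
Proof.
have := gausso_inv phi^-1%g; rewrite invgK => E.
suff: gausso psi phi^-1%g * g phi != 0 by rewrite mulf_eq0 => /norP[].
by rewrite E mulf_neq0 ?card_field_neq0 ?mchar_neq0 // oppr_eq0 oner_eq0.
Qed.

(** Reflection is applied to both Gauss sums of the quotient; the powers of [q] cancel and only the
    sign [nu (-1)] remains. *)
Lemma pocho_inv phi nu :
  (pocho psi phi nu)^-1 = nu (-1) * poch psi phi^-1%g nu^-1%g.
Proof.
have gE chi : gausso psi chi = chi (-1) * q / g (chi^-1)%g.
  by rewrite -gausso_inv mulfK ?gauss_neq0.
have N1 chi : chi (-1) != 0 by rewrite mchar_neq0 // oppr_eq0 oner_eq0.
rewrite /pocho /poch !gE mchar_mulE mchar_mulC -invgM.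
rewrite -[nu (-1) in RHS]mchar_invN1.
by field; rewrite ?card_field_neq0 ?gauss_neq0 ?N1.
Qed.

Lemma pocho_neq0 phi nu : pocho psi phi nu != 0.
Proof.
rewrite -invr_eq0 pocho_inv mulf_neq0 // ?mchar_neq0 ?oppr_eq0 ?oner_eq0 //.
by rewrite mulf_neq0 ?invr_eq0 ?gauss_neq0.
Qed.

End GaussSums.

(** * Hypergeometric sums and Euler's transformation *)

Section Hypergeometric.
Set Implicit Arguments.
Unset Strict Implicit.
Unset Printing Implicit Defensive.

Variables (F : finFieldType) (C : numClosedFieldType) (psi : F -> C).
Hypothesis (psiD : additive_character psi) (psiN : nontrivial_character psi).
Implicit Types (phi chi nu a b c : mchar F C) (x y z w : F).

Local Notation q := (#|F|%:R : C).
Local Notation g := (gauss psi).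

(* A constant multiple of the 2F1 with parameters (a, b; c): the reflection formula
   g(phi^-1) g^o(phi) = phi(-1) q turns its denominators into numerators. *)
Definition hyper a b c x : C :=
  \sum_nu g (a * nu)%g * g (c * nu)^-1%g * g (b * nu)%g * g nu^-1%g * nu x.

(** Analogue of Euler's integral of [t^(a-1) (1-t)^(c-a-1) (1-xt)^(-b)] for 2F1. *)
Definition euler_sum a b c x : C :=
  \sum_w a w * (c * a^-1)%g (1 - w) * b^-1%g (1 - x * w).

Lemma euler_sum_transform a b c x : x != 1 ->
  euler_sum a b c x =
  (c * a^-1 * b^-1)%g (1 - x) * euler_sum (c * a^-1)%g (c * b^-1)%g c x.
Proof.
move=> x1; have x10 : 1 - x != 0 by rewrite subr_eq0 eq_sym.
(* A Möbius map of trace 0 and determinant [x - 1], hence an involution away from its pole. *)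
pose h w : F := (1 - w) / (1 - x * w).
have h1 w : 1 - x * w != 0 -> 1 - h w = w * (1 - x) / (1 - x * w).
  by move=> w1; rewrite /h; field.
have hx w : 1 - x * w != 0 -> 1 - x * h w = (1 - x) / (1 - x * w).
  by move=> w1; rewrite /h; field.
have hx0 w : 1 - x * w != 0 -> 1 - x * h w != 0.
  by move=> w1; rewrite hx // mulf_neq0 ?invr_eq0.
have hK w : 1 - x * w != 0 -> h (h w) = w.
  by move=> w1; rewrite {1}/h h1 // hx //; field; rewrite w1 x10.
have supp (f1 f2 f3 : mchar F C) :
    \sum_w f1 w * f2 (1 - w) * f3 (1 - x * w) =
      \sum_(w | 1 - x * w != 0) f1 w * f2 (1 - w) * f3 (1 - x * w).
  rewrite (bigID (fun w => 1 - x * w != 0)) /= [X in _ + X]big1 ?addr0 // => w.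
  by rewrite negbK => /eqP->; rewrite mchar_ext0 mulr0.
rewrite /euler_sum !supp (reindex_onto h h) /= => [|w]; last exact: hK.
(* Division by zero gives [h w = 0] at the pole, so [h (h w) = 1]; but [w = 1] would force [x = 1].
   The reindexing thus drops the pole. *)
have pole w : 1 - x * w = 0 -> (h (h w) == w) = false.
  move=> E; have -> : h (h w) = 1.
    by rewrite {2}/h E invr0 mulr0 /h mulr0 subr0 divr1.
  by apply: contra_eqF E => /eqP<-; rewrite mulr1.
rewrite mulr_sumr; apply: eq_big => [w|w].
  have [/pole->|w1] := eqVneq (1 - x * w) 0; first by rewrite andbF.
  by rewrite hx0 // hK // eqxx.
have [/pole->|w1 _] := eqVneq (1 - x * w) 0; first by rewrite andbF.
rewrite h1 // hx // /h !mchar_evalE !invrK.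
have [->|w0] := eqVneq w 0; first by rewrite !mchar_ext0; ring.
have [->|w11] := eqVneq (1 - w) 0; first by rewrite !mchar_ext0; ring.
by field; rewrite ?mchar_neq0.
Qed.

(** Presents the pair, up to sign and a diagonal correction, as a Mellin transform in [nu]. The form
    [jacobi_alt] of the Jacobi sum is needed because there [nu] cancels from the factor in
    [1 - w]. *)
Lemma gauss_pair phi chi nu :
  g (phi * nu)%g * g (chi * nu)^-1%g =
  nu (-1) * ((phi == chi)%:R * (q - 1) * chi (-1)
    - g (phi * chi^-1)%g * phi (-1)
      * \sum_w (phi w * (chi * phi^-1)%g (1 - w)) * nu w).
Proof.
have -> : (phi == chi) = (phi * nu * (chi * nu)^-1 == 1)%g.
  by rewrite -eq_mulgV1 (inj_eq (mulIg nu)).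
rewrite gauss_mul // jacobi_alt.
have -> : (phi * nu * (chi * nu)^-1 = phi * chi^-1)%g by rewrite invMg !mulgA mulgK.
rewrite !mchar_evalE !mchar_invN1 mulrBr.
congr (_ - _); first by ring.
rewrite !mulr_sumr; apply: eq_bigr => w _; rewrite !mchar_evalE !invrK; ring.
Qed.

(** Two pairs of Gauss sums give a product of two Mellin transforms, and the sum over [nu] is their
    multiplicative convolution, an Euler sum. The corrections of [gauss_pair] leave the terms at
    [a = c] and [b = 1]; their product vanishes since [x != 1]. *)
Lemma hyper_euler_sum a b c x : x != 0 -> x != 1 ->
  hyper a b c x = (q - 1) * (g (a * c^-1)%g * g b * a (-1) * euler_sum a b c x
    - (a == c)%:R * (q - 1) * c (-1) * g b * b^-1%g (1 - x)
    - (b == 1%g)%:R * (q - 1) * g (a * c^-1)%g * c (-1) * c^-1%g x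
      * (c * a^-1)%g (1 - x)).
Proof.
move=> x0 x1; rewrite /hyper.
pose S phi chi nu := \sum_w (phi w * (chi * phi^-1)%g (1 - w)) * nu w.
have S_inv phi chi : \sum_nu S phi chi nu * nu x =
    (q - 1) * (chi (-1) * phi (-1) * chi^-1%g x * (chi * phi^-1)%g (1 - x)).
  transitivity ((q - 1) * (phi x^-1 * (chi * phi^-1)%g (1 - x^-1))).
    rewrite -(mchar_inversion (fun w => phi w * (chi * phi^-1)%g (1 - w))) //.
    apply: eq_bigr => nu _; rewrite mulr_suml; apply: eq_bigr => w _.
    by rewrite mchar_extM mulrA.
  have -> : 1 - x^-1 = - ((1 - x) / x) by field.
  rewrite mchar_extN !mchar_evalE mchar_invN1.
  have x10 : 1 - x != 0 by rewrite subr_eq0 eq_sym.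
  by field; rewrite ?mchar_neq0.
have SS_inv : \sum_nu S a c nu * S b 1%g nu * nu x =
    (q - 1) * b (-1) * euler_sum a b c x.
  rewrite /euler_sum mulr_sumr.
  under eq_bigr do rewrite /S -mulrA mulr_suml.
  rewrite exchange_big; apply: eq_bigr => w _ /=.
  have [->|w0] := eqVneq w 0.
    by rewrite big1 => [|nu _]; rewrite !mchar_ext0 ?mul0r ?mulr0.
  (* For fixed [w], inversion forces the second variable to be [(w * x)^-1]. *)
  transitivity (a w * (c * a^-1)%g (1 - w) *
     ((q - 1) * (b (w * x)^-1 * (1 * b^-1)%g (1 - (w * x)^-1)))).
    rewrite -(mchar_inversion (fun v => b v * (1 * b^-1)%g (1 - v))) ?mulf_neq0 //.
    rewrite mulr_sumr; apply: eq_bigr => nu _; rewrite -!mulrA; congr (_ * (_ * _)).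
    rewrite mulr_suml mulr_sumr; apply: eq_bigr => v _; rewrite !mchar_evalE; ring.
  have -> : 1 - (w * x)^-1 = - ((1 - x * w) / (w * x)) by field; rewrite w0 x0.
  rewrite mchar_extN mul1g !mchar_evalE mchar_invN1.
  have [->|xw0] := eqVneq (1 - x * w) 0; first by rewrite !mchar_ext0 invr0; ring.
  have [->|w1] := eqVneq (1 - w) 0; first by rewrite !mchar_ext0; ring.
  by field; rewrite ?mchar_neq0.
set A := (a == c)%:R; set B := (b == 1%g)%:R.
transitivity (\sum_(nu : mchar F C)
   (A * (q - 1) * c (-1) * (B * (q - 1)) * nu x
   - A * (q - 1) * c (-1) * g b * b (-1) * (S b 1%g nu * nu x)
   - B * (q - 1) * g (a * c^-1)%g * a (-1) * (S a c nu * nu x)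
   + g (a * c^-1)%g * a (-1) * g b * b (-1) * (S a c nu * S b 1%g nu * nu x))).
  apply: eq_bigr => nu _.
  transitivity (g (a * nu)%g * g (c * nu)^-1%g * (g (b * nu)%g * g (1 * nu)^-1%g) * nu x).
    by rewrite mul1g; ring.
  rewrite !gauss_pair invg1 mulg1 mchar_oneE oppr_eq0 oner_neq0 mulr1n -/A -/B.
  rewrite -/(S a c nu) -/(S b 1%g nu).
  (* The two factors [nu (-1)] multiply to 1; fixing the sign lets [ring] see it. *)
  by case: (mchar_signP nu) => ->; ring.
rewrite !big_split !sumrN /= -!mulr_sumr sum_mchar_at (negPf x1) !S_inv SS_inv.
rewrite mul1g invg1 !mchar_oneE x0 oppr_eq0 oner_neq0 mulr0n mulr1n.
rewrite !mchar_evalE.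
by case: (mchar_signP a) => ->; case: (mchar_signP b) => ->; ring.
Qed.

(** Both sides are reduced to the same Euler sum. The left has no correction as [a != c] and
    [b != 1]; on the right the corrections sit at [c / a = c] and [c / b = 1], that is at [a = 1]
    and [b = c]. *)
Lemma hyper_euler_transform a b c x :
  x != 0 -> x != 1 -> a != c -> b != 1%g -> ~~ ((a == 1%g) && (b == c)) ->
  g (c * b^-1)%g * g (c * a^-1)%g * hyper a b c x =
  (c * a^-1 * b^-1)%g (1 - x) * (g a * g b)
    * hyper (c * a^-1)%g (c * b^-1)%g c x
  + (q - 1) ^+ 2 * q * g c * c^-1%g x
    * ((b == c)%:R * a (-1) * c (-1)
       - (a == 1%g)%:R * b (-1) * (c * a^-1 * b^-1)%g (1 - x)).
Proof.
move=> x0 x1 ac b1 ab_deg.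
have x10 : 1 - x != 0 by rewrite subr_eq0 eq_sym.
have ca : (c * a^-1 == c)%g = (a == 1%g).
  by rewrite -[in X in _ == X](mulg1 c) (inj_eq (mulgI c)) -(inj_eq invg_inj) invgK invg1.
have cb : (c * b^-1 == 1)%g = (b == c) by rewrite -eq_mulgV1 eq_sym.
have Ea : (c * a^-1 * c^-1 = a^-1)%g by rewrite mchar_mulC mulKg.
have Eb : (c * (c * a^-1)^-1 = a)%g by rewrite invMg invgK mchar_mulC mulgKV.
have gcb : b != c -> g (c * b^-1)%g * g (c^-1 * b)%g = c (-1) * b (-1) * q.
  move=> bc; have := gauss_inv_neq1 psiD psiN (phi := (c * b^-1)%g).
  by rewrite (mchar_mulC c^-1) cb invMg invgK !mchar_evalE mchar_invN1; apply.
have gac : g (a * c^-1)%g * g (c * a^-1)%g = a (-1) * c (-1) * q.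
  have := gauss_inv_neq1 psiD psiN (phi := (a * c^-1)%g).
  by rewrite -eq_mulgV1 invMg invgK !mchar_evalE mchar_invN1; apply.
rewrite !hyper_euler_sum // (negPf ac) (negPf b1) ca cb Ea Eb.
rewrite (euler_sum_transform a b c x1).
set E' := euler_sum _ _ _ _; set X := (_ : mchar F C) (1 - x).
have -> : g (c * a^-1)%g = a (-1) * c (-1) * q / g (a * c^-1)%g.
  by rewrite -gac mulrC mulKf ?gauss_neq0.
have [a1|a1] := eqVneq a 1%g; last first.
  have -> : g a^-1%g = a (-1) * q / g a.
    by rewrite -(gauss_inv_neq1 psiD psiN a1) mulrC mulKf ?gauss_neq0.
  have [bc|bc] := eqVneq b c; last first.
    rewrite !mulr0n !mchar_evalE mchar_invN1.
    (* From here on only the nonvanishing of the Gauss sums matters, so [g] is generalised to an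
       arbitrary nowhere zero [G]. *)
    by move: g (gauss_neq0 psiD psiN) => G G0; field; rewrite !G0 !mchar_neq0.
  rewrite /X bc mulgV gauss1 // invg1 mulr0n mulr1n !mchar_evalE mchar_invN1.
  by move: g (gauss_neq0 psiD psiN) => G G0; case: (mchar_signP a) => ->;
    case: (mchar_signP c) => ->; field; rewrite !G0 !mchar_neq0.
move: ab_deg; rewrite a1 eqxx => /negPf bc.
rewrite /= in bc *; rewrite bc.
(* For [a = 1] the product [g a * g a^-1] is 1 and not [q], so the Euler sums on the two sides do
   not cancel and [E'] must be evaluated. It is a Jacobi sum after [w -> x * w], short of its term
   at [w = 1]. *)
have -> : E' = c^-1%g x * jacobi c (c^-1 * b) - (c^-1 * b)%g (1 - x).
  rewrite /E' a1 invg1 mulg1 /jacobi (reindex_inj (mulfI x0)) /= mulr_sumr.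
  apply: (canRL (addrK _)); rewrite [RHS](bigD1 1) //= [LHS]addrC; congr (_ + _).
    by rewrite mulr1 !mchar_evalE; field; rewrite !mchar_neq0.
  rewrite /euler_sum (bigD1 1) //= subrr mchar_ext0 mulr0 mul0r add0r.
  apply: eq_bigr => w w1; rewrite mulgV mchar_oneE subr_eq0 eq_sym w1 invMg invgK.
  rewrite mulr1n !mchar_evalE [X in _ * X]mulrC.
  by rewrite -!(mulrA (c x)) mulKf ?mchar_neq0 ?mulr1 ?mulrA.
have -> : jacobi c (c^-1 * b)%g = - g c * g (c^-1 * b)%g / g b.
  rewrite mulNr gauss_mul // mulKVg (negPf b1) mul0r sub0r opprK.
  by rewrite mulrC mulKf ?gauss_neq0.
have -> : g (c^-1 * b)%g = c (-1) * b (-1) * q / g (c * b^-1)%g.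
  by rewrite -gcb ?bc // mulrC mulKf ?gauss_neq0.
rewrite invg1 mul1g mulg1 gauss1 // mulr0n mulr1n !mchar_evalE.
rewrite !mchar_oneE x10 oppr_eq0 oner_neq0 !mulr1n.
by move: g (gauss_neq0 psiD psiN) => G G0; case: (mchar_signP b) => ->;
  case: (mchar_signP c) => ->; field; rewrite !G0 !mchar_neq0.
Qed.

(** * From Pochhammer symbols and formal sums to hypergeometric sums *)

Lemma prod_gen2 (h : mchar F C -> C) a b :
  \prod_chi h chi ^+ (gen a + gen b)%R chi = h a * h b.
Proof.
have one phi : \prod_chi h chi ^+ gen phi chi = h phi.
  rewrite (bigD1 phi) //= big1 => [|chi /negPf chi_phi]; rewrite ffunE ?chi_phi //.
  by rewrite eqxx mulr1.
(* Adding exponents factor by factor also covers [a = b], where the multiplicity is 2. *)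
rewrite -(one a) -(one b) -big_split /=; apply: eq_bigr => chi _.
by rewrite -exprD; congr (_ ^+ _); rewrite ffunE.
Qed.

Lemma pairing_gen_neq (u : formal_sum F C) a b :
  (0 < u a)%N -> pairing u (gen b) = 0%N -> a != b.
Proof.
move=> ua; apply: contra_eqN => /eqP ab; rewrite -lt0n /pairing.
rewrite (bigD1 a) //= addn_gt0 (bigD1 b) //= addn_gt0 ffunE eqxx muln1.
by rewrite /mdelta ab mulgV eqxx muln1 -ab ua.
Qed.

Lemma pocho1_inv nu : (pocho psi 1 nu)^-1 = nu (-1) * g nu^-1%g.
Proof. by rewrite pocho_inv // invg1 /poch mul1g gauss1 // divr1. Qed.

Lemma sum_poch_hyper (alpha beta gamma mu : mchar F C) x :
  \sum_(nu : mchar F C)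
    poch psi alpha (nu * mu) * poch psi gamma nu * poch psi (beta * gamma^-1) mu
    / (pocho psi beta (nu * mu) * pocho psi 1 nu * pocho psi 1 mu) * nu x =
  mu (-1) / (g beta^-1%g * pocho psi 1 mu) * g (beta * mu * gamma^-1)%g
    / (g (beta * gamma^-1)%g * g alpha * g gamma)
    * hyper (alpha * mu)%g gamma (beta * mu)%g x.
Proof.
rewrite /hyper mulr_sumr; apply: eq_bigr => nu _.
rewrite (invfM (pocho psi beta _ * _)) (invfM (pocho psi beta _)) pocho_inv // pocho1_inv.
have -> : poch psi beta^-1 (nu * mu)^-1 = g (beta * mu * nu)^-1%g / g beta^-1%g.
  by rewrite /poch -invMg (mchar_mulC nu) (mchar_mulC _ beta) mulgA.
have -> : poch psi alpha (nu * mu) = g (alpha * mu * nu)%g / g alpha.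
  by rewrite /poch (mchar_mulC nu) mulgA.
have -> : poch psi (beta * gamma^-1) mu = g (beta * mu * gamma^-1)%g / g (beta * gamma^-1)%g.
  by rewrite /poch -!mulgA (mchar_mulC mu).
rewrite /poch mchar_mulE.
have := pocho_neq0 psiD psiN 1 mu; set P := pocho _ _ _ => P0.
move: g (gauss_neq0 psiD psiN) => G G0.
by case: (mchar_signP nu) => ->; field; rewrite !G0 P0.
Qed.

(** Between the symbols in [eta] and those in [mu], the Gauss sums of [eta^-1] and of
    [beta * alpha^-1 * eta] cancel. Four factors in [eta] remain, and [eta = nu * mu] puts them in
    the shape of [hyper]. *)
Lemma sum_mpoch_hyper (alpha beta gamma mu : mchar F C) x :
  \sum_(eta : mchar F C) mpoch psi (gen (beta * alpha^-1) + gen (beta * gamma^-1)) eta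
    / mpocho psi (gen beta + gen 1) eta * eta x
    * (mpoch psi (gen alpha + gen eta^-1) mu
       / mpocho psi (gen (alpha * (beta * eta)^-1) + gen 1) mu) =
  mu (-1) / (g beta^-1%g * pocho psi 1 mu) * g (alpha * mu)%g
    / (g alpha * g (beta * alpha^-1)%g * g (beta * gamma^-1)%g)
    * mu x * hyper (beta * mu * (alpha * mu)^-1)%g (beta * mu * gamma^-1)%g (beta * mu)%g x.
Proof.
rewrite /hyper mulr_sumr (reindex_inj (mulIg mu)) /=; apply: eq_bigr => nu _.
rewrite /mpoch /mpocho !prod_gen2 (invfM (pocho psi beta _)) (invfM (pocho psi _ mu)).
rewrite pocho1_inv (pocho_inv psiD psiN beta) (pocho_inv psiD psiN (alpha * _)).
have -> : poch psi beta^-1 (nu * mu)^-1 = g (beta * mu * nu)^-1%g / g beta^-1%g.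
  by rewrite /poch -invMg (mchar_mulC nu) (mchar_mulC _ beta) mulgA.
have -> : (alpha * (beta * (nu * mu))^-1)^-1%g = (beta * alpha^-1 * (nu * mu))%g.
  by rewrite invMg invgK -mulgA (mchar_mulC (nu * mu)) mulgA.
rewrite /poch.
have -> : (beta * alpha^-1 * (nu * mu) * mu^-1 = beta * mu * (alpha * mu)^-1 * nu)%g.
  by rewrite mulgA mulgK invMg !mulgA mulgK.
have -> : (beta * gamma^-1 * (nu * mu) = beta * mu * gamma^-1 * nu)%g.
  by rewrite (mchar_mulC nu) -!mulgA (mulgA gamma^-1%g) (mchar_mulC _ mu) -!mulgA.
have -> : ((nu * mu)^-1 * mu = nu^-1)%g by rewrite invMg -mulgA (mchar_mulC _ mu) mulKg.
rewrite !mchar_mulE.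
have := pocho_neq0 psiD psiN 1 mu; set P := pocho _ _ _ => P0.
move: g (gauss_neq0 psiD psiN) => G G0.
by case: (mchar_signP nu) => ->; case: (mchar_signP mu) => ->; field; rewrite !G0 P0.
Qed.

(** Case [a = alpha * mu], [b = gamma], [c = beta * mu] of [hyper_euler_transform]: [alpha != beta]
    gives [a != c], and [alpha * gamma != beta] prevents [a = 1] and [b = c] from holding
    together. *)
Lemma poch_sum_transform (alpha beta gamma mu : mchar F C) x :
    x != 0 -> x != 1 -> alpha != beta -> (alpha * gamma)%g != beta -> gamma != 1%g ->
  \sum_(nu : mchar F C)
    poch psi alpha (nu * mu) * poch psi gamma nu * poch psi (beta * gamma^-1) mu
    / (pocho psi beta (nu * mu) * pocho psi 1 nu * pocho psi 1 mu) * nu x =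
  (alpha^-1 * gamma^-1 * beta)%g (1 - x)
    * (\sum_(eta : mchar F C) mpoch psi (gen (beta * alpha^-1) + gen (beta * gamma^-1)) eta
        / mpocho psi (gen beta + gen 1) eta * eta x
        * (mpoch psi (gen alpha + gen eta^-1) mu
           / mpocho psi (gen (alpha * (beta * eta)^-1) + gen 1) mu)) / mu x
  - (mu == alpha^-1)%g%:R * ((1 - q) ^+ 2 * (alpha * beta^-1)%g (- x) * alpha (-1)
      * (alpha^-1 * gamma^-1 * beta)%g (1 - x)
      * (pocho psi 1 beta / poch psi (gamma^-1) beta))
  + (mu == gamma * beta^-1)%g%:R * ((1 - q) ^+ 2 * gamma^-1%g x
      * (pocho psi 1 beta / pocho psi (alpha^-1) beta)).
Proof.
move=> x0 x1 ab agb c1; rewrite sum_poch_hyper sum_mpoch_hyper.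
have x10 : 1 - x != 0 by rewrite subr_eq0 eq_sym.
have q0 : q != 0 := card_field_neq0 F C.
have a1E : (alpha * mu == 1)%g = (mu == alpha^-1)%g.
  by rewrite -(inj_eq (mulgI alpha) mu) mulgV.
have bcE : (gamma == beta * mu)%g = (mu == gamma * beta^-1)%g.
  by rewrite -(inj_eq (mulIg beta) mu) mulgKV eq_sym mchar_mulC.
have amb : (alpha * mu)%g != (beta * mu)%g by rewrite (inj_eq (mulIg mu)).
have deg : ~~ ((alpha * mu == 1)%g && (gamma == beta * mu)%g).
  rewrite a1E; apply/negP => /andP[/eqP-> /eqP cE]; case/eqP: agb.
  by rewrite cE mchar_mulC mulgKV.
have := hyper_euler_transform x0 x1 amb c1 deg.
rewrite a1E bcE.
have -> : (beta * mu * (alpha * mu)^-1 * gamma^-1 = alpha^-1 * gamma^-1 * beta)%g.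
  by rewrite invMg !mulgA mulgK -mulgA mchar_mulC.
have -> : (beta * mu * (alpha * mu)^-1 = beta * alpha^-1)%g.
  by rewrite invMg !mulgA mulgK.
set H := hyper (alpha * mu)%g _ _ _; set H' := hyper _ _ _ _.
set X := (alpha^-1 * gamma^-1 * beta)%g (1 - x) => tr.
have gba : g (alpha * beta^-1)%g = alpha (-1) * beta (-1) * q / g (beta * alpha^-1)%g.
  have := gauss_inv_neq1 psiD psiN (phi := (alpha * beta^-1)%g).
  rewrite -eq_mulgV1 invMg invgK !mchar_evalE mchar_invN1 => <- //.
  by rewrite mulfK ?gauss_neq0.
have poch1E : pocho psi 1 beta = beta (-1) / g beta^-1%g.
  by rewrite -[LHS]invrK pocho1_inv invfM mchar_invN1.
have pochaE : (pocho psi alpha^-1 beta)^-1 = beta (-1) * (g (alpha * beta^-1)%g / g alpha).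
  by rewrite pocho_inv // invgK.
have gamE : g gamma^-1%g = gamma (-1) * q / g gamma.
  by rewrite -(gauss_inv_neq1 psiD psiN c1) mulrC mulKf ?gauss_neq0.
have -> : poch psi gamma^-1 beta = g (beta * gamma^-1)%g / g gamma^-1%g.
  by rewrite /poch mchar_mulC.
rewrite poch1E pochaE gba gamE.
have P1 : pocho psi 1 mu = mu (-1) / g mu^-1%g.
  by rewrite -[LHS]invrK pocho1_inv invfM mchar_invN1.
(* Solving the transformation for [H] leaves a rational identity in [H'], Gauss sums and character
   values, checked separately at each exceptional [mu] and at all others. *)
have -> : H = (X * (g (alpha * mu)%g * g gamma) * H'
   + (q - 1) ^+ 2 * q * g (beta * mu)%g * (beta * mu)^-1%g x
      * ((mu == gamma * beta^-1)%g%:R * (alpha * mu)%g (-1) * (beta * mu)%g (-1)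
       - (mu == alpha^-1)%g%:R * gamma (-1) * X))
   / (g (beta * mu * gamma^-1)%g * g (beta * alpha^-1)%g).
  by rewrite -tr mulrC mulKf // mulf_neq0 ?gauss_neq0.
rewrite P1.
move: deg; rewrite a1E bcE.
have [muE|_] := eqVneq mu alpha^-1%g.
  have [//|_] := eqVneq mu (gamma * beta^-1)%g => _.
  rewrite muE mulgV invgK gauss1 // mulr0n mulr1n mchar_extN !mchar_evalE !invrK mchar_invN1.
  move: g (gauss_neq0 psiD psiN) => G G0.
  by case: (mchar_signP alpha) => ->; case: (mchar_signP beta) => ->;
    case: (mchar_signP gamma) => ->; field; rewrite !G0 !mchar_neq0.
case: (eqVneq mu (gamma * beta^-1)%g) => [muE _|_ _].
  have -> : (beta * mu = gamma)%g by rewrite muE mchar_mulC mulgKV.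
  rewrite mulgV gauss1 // muE invMg invgK mulr0n mulr1n !mchar_evalE !mchar_invN1.
  move: g (gauss_neq0 psiD psiN) => G G0.
  by case: (mchar_signP alpha) => ->; case: (mchar_signP beta) => ->;
    case: (mchar_signP gamma) => ->; field; rewrite !G0 ?q0 !mchar_neq0 ?oppr_eq0.
rewrite !mulr0n; move: g (gauss_neq0 psiD psiN) => G G0.
by case: (mchar_signP mu) => ->; field; rewrite !G0 ?q0 !mchar_neq0 ?oppr_eq0 ?oner_neq0.
Qed.

(** Both sides are linear in [f], so [poch_sum_transform] is summed against [f mu * mu y]. *)
Lemma appell_transform (alpha beta gamma : mchar F C)
  (alpha_beta : pairing (gen alpha + gen (alpha * gamma)) (gen beta) = 0%N)
  (gamma_1 : pairing (gen gamma) (gen 1) = 0%N)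
  (f : mchar F C -> C) (x y : F) (x_neq0 : x <> 0) (x_neq1 : x <> 1) :
  \sum_(nu : mchar F C) \sum_(mu : mchar F C)
     f mu
     * (poch psi alpha (nu * mu) * poch psi gamma nu
          * poch psi (beta * gamma^-1) mu
        / (pocho psi beta (nu * mu) * pocho psi 1 nu * pocho psi 1 mu))
     * nu x * mu y
  = (alpha^-1 * gamma^-1 * beta)%g (1 - x)
    * (\sum_(eta : mchar F C)
         mpoch psi (gen (beta * alpha^-1) + gen (beta * gamma^-1)) eta
         / mpocho psi (gen beta + gen 1) eta
         * eta x
         * \sum_(mu : mchar F C)
             f mu
             * (mpoch psi (gen alpha + gen eta^-1) mu
                / mpocho psi (gen (alpha * (beta * eta)^-1) + gen 1) mu)
             * mu (y / x))
    - (1 - q) ^+ 2 * f (alpha^-1)%g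
      * (alpha * beta^-1)%g (- x) * (alpha^-1)%g (- y)
      * (alpha^-1 * gamma^-1 * beta)%g (1 - x)
      * (pocho psi 1 beta / poch psi (gamma^-1) beta)
    + (1 - q) ^+ 2 * f (gamma * beta^-1)%g
      * (gamma^-1)%g x * (gamma * beta^-1)%g y
      * (pocho psi 1 beta / pocho psi (alpha^-1) beta).
Proof.
have x0 : x != 0 by apply/eqP.
have x1 : x != 1 by apply/eqP.
have ab : alpha != beta by apply: pairing_gen_neq alpha_beta; rewrite !ffunE eqxx.
have agb : (alpha * gamma)%g != beta.
  by apply: pairing_gen_neq alpha_beta; rewrite !ffunE eqxx; case: eqP.
have c1 : gamma != 1%g by apply: pairing_gen_neq gamma_1; rewrite ffunE eqxx.
(* The indicators select one [mu] each: hence the isolated values of [f] at [alpha^-1] and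
   [gamma * beta^-1]. *)
have sum_pick (a : mchar F C) D :
    \sum_(mu : mchar F C) f mu * mu y * ((mu == a)%:R * D) = f a * a y * D.
  rewrite (bigD1 a) //= eqxx mul1r big1 ?addr0 // => mu /negPf->.
  by rewrite mul0r mulr0.
rewrite exchange_big /= mulr_sumr.
transitivity (\sum_(mu : mchar F C) f mu * mu y *
    (\sum_(nu : mchar F C)
       poch psi alpha (nu * mu) * poch psi gamma nu * poch psi (beta * gamma^-1) mu
       / (pocho psi beta (nu * mu) * pocho psi 1 nu * pocho psi 1 mu) * nu x)).
  apply: eq_bigr => mu _; rewrite mulr_sumr; apply: eq_bigr => nu _.
  have AC (u v w z : C) : u * v * w * z = u * z * (v * w) by ring.
  exact: AC.
under eq_bigr => mu _ do rewrite poch_sum_transform // mulrDr mulrBr.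
rewrite !big_split sumrN /= !sum_pick; congr (_ - _ + _).
- under [RHS]eq_bigr do rewrite !mulr_sumr.
  rewrite [RHS]exchange_big; apply: eq_bigr => mu _ /=.
  rewrite mulr_sumr mulr_suml mulr_sumr; apply: eq_bigr => eta _.
  rewrite mchar_extM mchar_extV.
  have AC (t u v w z X : C) : t * u * (X * (v * w) / z) = X * (v * (t * w * (u / z))).
    by ring.
  exact: AC.
- rewrite (mchar_extN _ y) !mchar_invE mchar_invN1.
  have AC (t u v w z X q' : C) : t * u * (q' * v * w * X * z) = q' * t * v * (w * u) * X * z.
    by ring.
  exact: AC.
- have AC (t u v z q' : C) : t * u * (q' * v * z) = q' * t * v * u * z by ring.
  exact: AC.
Qed.

End Hypergeometric.

Theorem theorem3p5 (R : realType) (F : finFieldType)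
  (psi : F -> R[i]) (psiD : additive_character psi)
  (psi_nontrivial : nontrivial_character psi)
  (alpha beta gamma : mchar F R[i])
  (alpha_beta : pairing (gen alpha + gen (alpha * gamma)) (gen beta) = 0%N)
  (gamma_1 : pairing (gen gamma) (gen 1) = 0%N)
  (f : mchar F R[i] -> R[i]) (x y : F) (x_neq0 : x <> 0) (x_neq1 : x <> 1) :
  \sum_(nu : mchar F R[i]) \sum_(mu : mchar F R[i])
     f mu
     * (poch psi alpha (nu * mu) * poch psi gamma nu
          * poch psi (beta * gamma^-1) mu
        / (pocho psi beta (nu * mu) * pocho psi 1 nu * pocho psi 1 mu))
     * nu x * mu y
  = (alpha^-1 * gamma^-1 * beta)%g (1 - x)
    * (\sum_(eta : mchar F R[i])
         mpoch psi (gen (beta * alpha^-1) + gen (beta * gamma^-1)) eta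
         / mpocho psi (gen beta + gen 1) eta
         * eta x
         * \sum_(mu : mchar F R[i])
             f mu
             * (mpoch psi (gen alpha + gen eta^-1) mu
                / mpocho psi (gen (alpha * (beta * eta)^-1) + gen 1) mu)
             * mu (y / x))
    - (1 - #|F|%:R) ^+ 2 * f (alpha^-1)%g
      * (alpha * beta^-1)%g (- x) * (alpha^-1)%g (- y)
      * (alpha^-1 * gamma^-1 * beta)%g (1 - x)
      * (pocho psi 1 beta / poch psi (gamma^-1) beta)
    + (1 - #|F|%:R) ^+ 2 * f (gamma * beta^-1)%g
      * (gamma^-1)%g x * (gamma * beta^-1)%g y
      * (pocho psi 1 beta / pocho psi (alpha^-1) beta).
Proof. exact: appell_transform. Qed.
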